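(* Let $\mathbf{K}=\{K_t\}_{t\in\mathbb{R}}$ and $\mathbf{L}=\{L_t\}_{t\in\mathbb{R}}$ be two simplicial filtrations over the same underlying vertex set $V$. Then (for $q\in\mathbb{N}$ and a positive integer $k$) $$d_{\mathrm I}\left(\lambda_{q,\mathrm{up},k}^{\mathbf K},\lambda_{q,\mathrm{up},k}^{\mathbf L}\right)\le d_{\mathrm I}^V(\mathbf K,\mathbf L),$$ where $\lambda_{q,\mathrm{up},k}^{\mathbf K}:\mathbf{Int}\to\mathbb{R}_{\ge0}$ is defined by sending $I=[a,b]\in\mathbf{Int}$ to the $k$-th up-persistent eigenvalue $\lambda_{q,\mathrm{up},k}^{a,b}(\mathbf K)$, and similarly for $\mathbf L$.
   Context: A simplicial complex $K$ over a finite totally ordered set $V$ is a collection of nonempty subsets of $V$ closed under taking nonempty subsets. $\mathbb{N}$ is the set of non-negative integers. $S_q^K$ is the set of $q$-simplices (elements of cardinality $q+1$). Every complex $K$ carries a weight function $w^K:K\to(0,\infty)$. For $\sigma\in S_q^K$, $[\sigma]$ is $\sigma$ oriented by the order of $V$. $C_q^K$ is the real vector space with basis $\{[\sigma]:\sigma\in S_q^K\}$ (and $C_{-1}^K=0$), with the inner product $\langle[\sigma],[\sigma']\rangle=\delta_{\sigma\sigma'}\,(w^K(\sigma))^{-1}$. The boundary operator is $\partial_q^K[v_0,\dots,v_q]=\sum_{i=0}^q(-1)^i[v_0,\dots,\hat v_i,\dots,v_q]$ for $q\geq 1$ (the hat denotes omission), and $\partial_0^K=0$. A simplicial pair $K\hookrightarrow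 L$ consists of simplicial complexes $K\subseteq L$ over the same $V$ with $w^K=w^L|_K$. Put $C_{q}^{L,K}=\{c\in C_q^L:\partial_q^L c\in C_{q-1}^K\}$, with the inner product restricted from $C_q^L$, and let $\partial_q^{L,K}:C_q^{L,K}\to C_{q-1}^K$ be the restriction of $\partial_q^L$. The $q$-th up persistent Laplacian is $\Delta_{q,\mathrm{up}}^{K,L}=\partial_{q+1}^{L,K}(\partial_{q+1}^{L,K})^*$ on $C_q^K$ ($*$ denotes the adjoint). A simplicial filtration $\mathbf K=\{K_t\}_{t\in\mathbb R}$ over $V$ is a family of simplicial complexes over $V$ such that $K_s\hookrightarrow K_t$ is a simplicial pair for all $s\le t$. For $s\le t$, the $k$-th up-persistent eigenvalue $\lambda_{q,\mathrm{up},k}^{s,t}(\mathbf K)$ is the $k$-th smallest eigenvalue (counted with multiplicity) of $\Delta_{q,\mathrm{up}}^{K_s,K_t}$. The interleaving distance between filtrations is $d_{\mathrm I}^V(\mathbf K,\mathbf L)=\inf\{\varepsilon\ge0:\forall t\in\mathbb R,\ K_t\subseteq L_{t+\varepsilon}\text{ and }L_t\subseteq K_{t+\varepsilon}\}$, where an inclusion $K\subseteq L$ implicitly requires $w^K=w^L|_K$. $\mathbf{Int}$ is the set of closed intervals $[a,b]$ in $\mathbb{R}$; for $I=[a,b]$ and $\varepsilon\ge0$, $I^\varepsilon=[a-\varepsilon,b+\varepsilon]$. For $f,g:\mathbf{Int}\to\mathbb{R}_{\ge0}$, $d_{\mathrm I}(f,g)=\inf\{\varepsilon\ge0:\forall I\in\mathbf{Int},\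 f(I^\varepsilon)\ge g(I)\text{ and }g(I^\varepsilon)\ge f(I)\}$. The infimum of the empty set is $\infty$.
   Formalization: When k exceeds dim C_q^{K_a}, so that no k-th eigenvalue exists and the stated function into the non-negative reals is undefined, the k-th up-persistent eigenvalue is taken to be +∞; the functions on Int therefore take extended real values. *)

(* Defs.v *)
From HB Require Import structures.
From mathcomp Require Import all_boot all_order all_algebra.
From mathcomp Require Import polyrcf.
From mathcomp Require Import boolp classical_sets reals.
From mathcomp Require Import constructive_ereal interval_inference ereal.

Set Implicit Arguments.
Unset Strict Implicit.
Unset Printing Implicit Defensive.

Import Order.TTheory GRing.Theory Num.Theory.
Local Open Scope ring_scope.

Section Eigenvalues.

Section Adjoint.
Context {F : realFieldType} {U W : vectType F}.
Variables (dU : U -> U -> F) (dW : W -> W -> F).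

Definition is_adjoint (f : 'Hom(U, W)) (g : 'Hom(W, U)) : Prop :=
  forall u w, dW (f u) w = dU u (g w).

(* The adjoint of [f] with respect to the inner products [dU] and [dW]; it
   exists and is unique by [adjointP] and [adjoint_uniq]. *)
Definition adjoint (f : 'Hom(U, W)) : 'Hom(W, U) :=
  xget 0 [set g | is_adjoint f g]%classic.

Hypothesis dU_linl : forall a x y z, dU (a *: x + y) z = a * dU x z + dU y z.
Hypothesis dU_sym : forall x y, dU x y = dU y x.
Hypothesis dU_def : forall x, dU x x = 0 -> x = 0.

Lemma adjoint_uniq f g g' : is_adjoint f g -> is_adjoint f g' -> g = g'.
Proof.
move=> fg fg'; apply/lfunP => w; apply/eqP; rewrite -subr_eq0; apply/eqP.
apply: dU_def; pose x := g w - g' w.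
have -> : dU x x = dU (g w) x - dU (g' w) x.
  by rewrite {1}/x addrC -scaleN1r dU_linl mulN1r addrC.
by rewrite (dU_sym (g w)) (dU_sym (g' w)) -fg -fg' subrr.
Qed.

Hypothesis dW_linl : forall a x y z, dW (a *: x + y) z = a * dW x z + dW y z.
Hypothesis dW_sym : forall x y, dW x y = dW y x.

Lemma adjointP f : is_adjoint f (adjoint f).
Proof.
suff [g fg] : exists g, is_adjoint f g.
  exact: (@xgetPex _ 0 [set g | is_adjoint f g]%classic (ex_intro _ g fg)).
pose n := \dim {:U}; pose e : n.-tuple U := vbasis {:U}.
pose Phi (z : U) : 'rV[F]_n := \row_i dU e`_i z.
pose Psi (w : W) : 'rV[F]_n := \row_i dW (f e`_i) w.
have PhiL : linear Phi.
  by move=> a x y; apply/rowP => i; rewrite !mxE !(dU_sym e`_i) dU_linl.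
have PsiL : linear Psi.
  by move=> a x y; apply/rowP => i; rewrite !mxE !(dW_sym (f e`_i)) dW_linl.
pose PhiM := GRing.isLinear.Build _ _ _ _ Phi PhiL.
pose PsiM := GRing.isLinear.Build _ _ _ _ Psi PsiL.
pose PhiT : {linear U -> 'rV[F]_n} := HB.pack Phi PhiM.
pose PsiT : {linear W -> 'rV[F]_n} := HB.pack Psi PsiM.
have dU0 z : dU 0 z = 0.
  by have := dU_linl (-1) 0 0 z; rewrite scaler0 addr0 mulN1r addNr.
have dW0 z : dW 0 z = 0.
  by have := dW_linl (-1) 0 0 z; rewrite scaler0 addr0 mulN1r addNr.
have dUsum (a : 'I_n -> F) z :
    dU (\sum_i a i *: e`_i) z = \sum_i a i * dU e`_i z.
  elim/big_rec2: _ => [|i x y _ <-]; first exact: dU0.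
  by rewrite dU_linl.
have dWsum (a : 'I_n -> F) z :
    dW (\sum_i a i *: f e`_i) z = \sum_i a i * dW (f e`_i) z.
  elim/big_rec2: _ => [|i x y _ <-]; first exact: dW0.
  by rewrite dW_linl.
have inj : lker (linfun PhiT) == 0%VS.
  rewrite -subv0; apply/subvP => z; rewrite memv_ker lfunE /= => /eqP Pz.
  rewrite memv0; apply/eqP; apply: dU_def.
  rewrite {1}(coord_vbasis (memvf z)) dUsum big1// => i _.
  by have /rowP/(_ i) := Pz; rewrite !mxE => ->; rewrite mulr0.
have surj v : exists z, Phi z = v.
  have im : limg (linfun PhiT) = fullv.
    apply/eqP; rewrite eqEdim subvf /= limg_dim_eq; last first.
      by move/eqP: inj => ->; rewrite capv0.
    by rewrite dimvf /dim /= mul1n.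
  have : v \in limg (linfun PhiT) by rewrite im memvf.
  by case/memv_imgP => z _ ->; exists z; rewrite lfunE.
exists ((linfun PhiT)^-1 \o linfun PsiT)%VF => u w.
have Pg : Phi (((linfun PhiT)^-1 \o linfun PsiT)%VF w) = Psi w.
  rewrite lfunE /= [linfun PsiT w]lfunE /=.
  have [z <-] := surj (Psi w).
  have -> : Phi z = linfun PhiT z by rewrite lfunE.
  by rewrite lker0_lfunK // lfunE.
rewrite [in LHS](coord_vbasis (memvf u)) [in RHS](coord_vbasis (memvf u)).
rewrite linear_sum /=; under eq_bigr do rewrite linearZ /=.
rewrite dWsum dUsum; apply: eq_bigr => i _.
by have /rowP/(_ i) := Pg; rewrite !mxE => ->.
Qed.

End Adjoint.

Context {R : realType} {U : vectType R}.

Definition charpoly (f : 'End(U)) : {poly R} :=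
  char_poly (passmx.mxof (vbasis {:U}) (vbasis {:U}) f).

(* The nondecreasing sequence of the real eigenvalues of [f], repeated according
   to their multiplicity; all the eigenvalues are real when [f] is
   self-adjoint. *)
Definition spectrum (f : 'End(U)) : seq R :=
  flatten [seq nseq (mup a (charpoly f)) a | a <- rootsR (charpoly f)].

(* The [k]-th smallest eigenvalue, [k] being counted from 1. It is [+oo] when
   there are fewer than [k] eigenvalues, in accordance with the min-max formula,
   where it is an infimum over an empty set. *)
Definition kth_eigenvalue (k : nat) (f : 'End(U)) : \bar R :=
  if (0 < k <= size (spectrum f))%N then ((spectrum f)`_k.-1)%:E else +oo%E.

End Eigenvalues.

(* All the chains live in the space with basis all the subsets of V, of which
   the chain spaces are subspaces. *)
Notation chains R V := {ffun {set V} -> R^o}.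

Section Complexes.
Context {R : realType} {d : Order.disp_t} {V : finOrderType d}.

(* Only the values of [weight] on the simplices are meaningful. *)
Record complex := Complex {
  simplices :> {set {set V}};
  weight : {set V} -> R;
  simplex_neq0 : forall s, s \in simplices -> s != finset.set0;
  simplex_sub : forall s t : {set V}, s \in simplices -> t \subset s ->
    t != finset.set0 -> t \in simplices;
  weight_gt0 : forall s, s \in simplices -> 0 < weight s }.

Implicit Types (K L : complex) (s t : {set V}) (q : nat).

Definition simplicial_pair K L : Prop :=
  (simplices K \subset simplices L) /\ {in simplices K, weight K =1 weight L}.

Definition qsimplices q K : {set {set V}} :=
  [set s in simplices K | #|s| == q.+1]%SET.

Definition osimplex s : chains R V := [ffun t => (t == s)%:R].

Definition chain q K : {vspace chains R V} :=
  <<[seq osimplex s | s in qsimplices q K]>>%VS.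

Definition cdot q K (c c' : chains R V) : R :=
  \sum_(s in qsimplices q K) c s * c' s / weight K s.

Lemma cdotC q K c c' : cdot q K c c' = cdot q K c' c.
Proof. by apply: eq_bigr => s _; rewrite (mulrC (c s)). Qed.

Lemma cdotPl q K a c1 c2 c :
  cdot q K (a *: c1 + c2) c = a * cdot q K c1 c + cdot q K c2 c.
Proof.
rewrite /cdot mulr_sumr -big_split; apply: eq_bigr => s _ /=.
by rewrite !ffunE /GRing.scale /= !mulrDl !mulrA.
Qed.

Lemma cdot_osimplex q K s t : s \in qsimplices q K -> t \in qsimplices q K ->
  cdot q K (osimplex s) (osimplex t) = (s == t)%:R * (weight K s)^-1.
Proof.
move=> sK tK; rewrite /cdot (bigD1 s) //= big1 ?addr0.
  by rewrite !ffunE eqxx mul1r.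
by move=> u /andP[_ /negbTE us]; rewrite ffunE us !mul0r.
Qed.

Lemma chain_supp q K (c : chains R V) s :
  c \in chain q K -> s \notin qsimplices q K -> c s = 0.
Proof.
move=> cK sK; pose X := [seq osimplex t | t in qsimplices q K].
have -> : c = \sum_i coord (in_tuple X) i c *: X`_i by apply: coord_span.
rewrite sum_ffunE big1 // => i _; rewrite ffunE.
have Xi : X`_i \in X by rewrite mem_nth.
have [t tK ->] := fintype.imageP Xi.
rewrite ffunE; case: eqP => [st|_]; last by rewrite scaler0.
by rewrite st tK in sK.
Qed.

Lemma cdot_def q K (c : chains R V) :
  c \in chain q K -> cdot q K c c = 0 -> c = 0.
Proof.
move=> cK c0; apply/ffunP => s; rewrite ffunE.
have [sK|/(chain_supp cK)//] := boolP (s \in qsimplices q K).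
have wP t : t \in qsimplices q K -> 0 < weight K t.
  by rewrite finset.inE => /andP[tK _]; exact: weight_gt0.
have ge0 t : t \in qsimplices q K -> 0 <= c t * c t / weight K t.
  by move=> tK; rewrite divr_ge0 ?(ltW (wP _ tK)) // -expr2 sqr_ge0.
have /eqP := psumr_eq0P ge0 c0 sK.
rewrite mulf_eq0 invr_eq0 (gt_eqF (wP _ sK)) orbF -expr2 sqrf_eq0.
by move/eqP.
Qed.

(* If v = v_i in s = {v_0 < ... < v_q}, then i is the number of elements of s
   below v. *)
Definition osimplex_boundary s : chains R V :=
  if (1 < #|s|)%N then
    \sum_(v in s) (-1) ^+ #|[set u in s | (u < v)%O]%SET| *: osimplex (s :\ v)%SET
  else 0.

(* The linear extension of [osimplex_boundary]; it restricts to the boundary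
   operators of all complexes in all degrees. *)
Definition boundary : 'End(chains R V) :=
  linfun (fun c : chains R V => \sum_s c s *: osimplex_boundary s).

Lemma boundaryE (c : chains R V) :
  boundary c = \sum_s c s *: osimplex_boundary s.
Proof.
pose b (c : chains R V) := \sum_s c s *: osimplex_boundary s.
have bL : linear b.
  move=> a x y; rewrite /b scaler_sumr -big_split; apply: eq_bigr => s _ /=.
  by rewrite !ffunE scalerDl scalerA.
pose bM := GRing.isLinear.Build _ _ _ _ b bL.
pose bT : {linear chains R V -> chains R V} := HB.pack b bM.
exact: (lfunE bT).
Qed.

Lemma boundary_osimplex s : boundary (osimplex s) = osimplex_boundary s.
Proof.
rewrite boundaryE (bigD1 s) //= big1 => [|t /negbTE ts]; rewrite ffunE.
  by rewrite eqxx scale1r addr0.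
by rewrite ts scale0r.
Qed.

(* C_{q+1}^{L,K}; in degree 0 this space does not enter the up-Laplacians. *)
Definition pchain q K L : {vspace chains R V} :=
  (chain q.+1 L :&: (boundary @^-1: chain q K))%VS.

(* \partial_{q+1}^{L,K} *)
Definition pboundary q K L :
    'Hom(subvs_of (pchain q K L), subvs_of (chain q K)) :=
  linfun (vsproj (chain q K) \o boundary \o vsval).

Lemma pboundaryE q K L (c : subvs_of (pchain q K L)) :
  vsval (pboundary q K L c) = boundary (vsval c).
Proof.
rewrite lfunE /= vsprojK //.
by have := subvsP c; rewrite memv_cap => /andP[_]; rewrite -memv_preim.
Qed.

Definition pcoboundary q K L :
    'Hom(subvs_of (chain q K), subvs_of (pchain q K L)) :=
  adjoint (fun x y => cdot q.+1 L (vsval x) (vsval y))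
          (fun x y => cdot q K (vsval x) (vsval y)) (pboundary q K L).

Lemma pcoboundaryP q K L (x : subvs_of (pchain q K L))
    (y : subvs_of (chain q K)) :
  cdot q K (vsval (pboundary q K L x)) (vsval y) =
  cdot q.+1 L (vsval x) (vsval (pcoboundary q K L y)).
Proof.
rewrite /pcoboundary.
set dU := fun x y : subvs_of (pchain q K L) => _.
set dW := fun x y : subvs_of (chain q K) => _.
apply: (@adjointP R _ _ dU dW) => [||z||]; rewrite ?/dU ?/dW /=.
- by move=> a u v w; rewrite cdotPl.
- by move=> u v; rewrite cdotC.
- move=> z0; apply: val_inj; apply: cdot_def z0.
  by have := subvsP z; rewrite memv_cap => /andP[].
- by move=> a u v w; rewrite cdotPl.
- by move=> u v; rewrite cdotC.
Qed.

Definition up_laplacian q K L : 'End(subvs_of (chain q K)) :=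
  (pboundary q K L \o pcoboundary q K L)%VF.

Record filtration := Filtration {
  stage :> R -> complex;
  stage_pair : forall a b : R, a <= b -> simplicial_pair (stage a) (stage b) }.

Definition up_eigenvalue q k (K : filtration) (a b : R) : \bar R :=
  kth_eigenvalue k (up_laplacian q (K a) (K b)).

Definition filtration_dist (K L : filtration) : \bar R :=
  ereal_inf [set e%:num%:E | e in [set e : {nonneg R} | forall t : R,
    simplicial_pair (K t) (L (t + e%:num)) /\
    simplicial_pair (L t) (K (t + e%:num))]]%classic.

End Complexes.

Arguments complex R {d} V.
Arguments filtration R {d} V.

Section Intervals.
Context {R : realType}.

Record Int := MkInt { lo : R; hi : R; lo_le_hi : lo <= hi }.

Lemma thicken_proof (I : Int) (e : {nonneg R}) :
  lo I - e%:num <= hi I + e%:num.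
Proof. by apply: lerD; [exact: lo_le_hi | rewrite ge0_cp]. Qed.

Definition thicken (I : Int) (e : {nonneg R}) : Int :=
  MkInt (thicken_proof I e).

Definition interval_dist (f g : Int -> \bar R) : \bar R :=
  ereal_inf [set e%:num%:E | e in [set e : {nonneg R} | forall I,
    (g I <= f (thicken I e))%E /\ (f I <= g (thicken I e))%E]]%classic.

Definition up_eigenvalue_fun (d : Order.disp_t) (V : finOrderType d)
    (q k : nat) (K : filtration R V) (I : Int) : \bar R :=
  up_eigenvalue q k K (lo I) (hi I).

End Intervals.

Arguments Int : clear implicits.

(* Main.v *)
From HB Require Import structures.
From mathcomp Require Import complex.
Require Import Defs.
From mathcomp Require Import all_boot all_order all_algebra.
From mathcomp Require Import polyrcf ring lra.
From mathcomp Require Import boolp classical_sets reals.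
From mathcomp Require Import constructive_ereal interval_inference ereal.

Set Implicit Arguments.
Unset Strict Implicit.
Unset Printing Implicit Defensive.

Import Order.TTheory GRing.Theory Num.Theory.
Import passmx.
Local Open Scope ring_scope.

(** The statement reduces to a monotonicity property of the up-persistent
    eigenvalues: for simplicial pairs [K1] in [K2] and [L1] in [L2],

      [kth (up_laplacian q K2 L1) <= kth (up_laplacian q K1 L2)]

    ([up_laplacian_kth_mono]). Indeed, if [K] and [L] are [e]-interleaved, then
    for every interval from [a] to [b] the stage of [K] at [a - e] is contained
    in that of [L] at [a], and the stage of [L] at [b] in that of [K] at
    [b + e], so the eigenvalue of [L] on the interval is at most that of [K] on
    the thickened one, and symmetrically. Every [e] in the set defining the
    distance of the filtrations is therefore in the set defining the distance of
    the eigenvalue functions.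

    Enlarging the small complex enlarges the space on which the Laplacian acts,
    which lowers the eigenvalues, but also its quadratic form on the chains of
    the smaller complex, which raises them; so restricting the form does not
    suffice, and the monotonicity is proved by lifting. Write [D z] for the coboundary of
    a chain [z] of [K2] relative to [K2] and [L1], and [D' x] for that of a
    chain [x] of [K1] relative to [K1] and [L2]; the quadratic forms of the
    two Laplacians are the squared lengths of [D z] and [D' x]. By an
    orthogonality argument ([pcoboundary_lift]), every [x] is the restriction to
    [K1] of a chain [z] of [K2] such that the boundary of [D z] is supported in
    [K1]. For such a [z], the adjunction between boundary and coboundary gives
    [<D z, D z> = <D z, D' x>], so [D z] is no longer than [D' x], whereas [z]
    is at least as long as [x]. The Rayleigh quotient thus decreases from [x] to
    [z], and the min-max principle ([kth_eigenvalue_compare]) concludes.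

    The min-max principle itself rests on the spectral theorem for self-adjoint
    endomorphisms of a real space ([orthogonal_eigenbasis]): a complex
    eigenvector provides a real one, and induction on the dimension an
    orthogonal eigenbasis. The characteristic polynomial then splits, and the
    spectrum is the sorted list of the eigenvalues of the basis. *)

(** * Inner products on finite-dimensional spaces *)

Definition inner_product (R : realFieldType) (U : vectType R)
    (dot : U -> U -> R) :=
  [/\ forall a x y z, dot (a *: x + y) z = a * dot x z + dot y z,
      forall x y, dot x y = dot y x
    & forall x, x != 0 -> 0 < dot x x].

Section InnerProduct.
Context {R : realFieldType} {U : vectType R} {dot : U -> U -> R}.
Hypothesis dotP : inner_product dot.

Let dotC x y : dot x y = dot y x. Proof. by case: dotP. Qed.

Lemma dotPl a x y z : dot (a *: x + y) z = a * dot x z + dot y z.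
Proof. by case: dotP. Qed.

Lemma dot_gt0 x : x != 0 -> 0 < dot x x.
Proof. by case: dotP => _ _; apply. Qed.

Lemma dotDl x y z : dot (x + y) z = dot x z + dot y z.
Proof. by rewrite -{1}(scale1r x) dotPl mul1r. Qed.

Lemma dot0l z : dot 0 z = 0.
Proof. by rewrite -[X in dot X z](addNr 0) -scaleN1r dotPl mulN1r addNr. Qed.

Lemma dotZl a x z : dot (a *: x) z = a * dot x z.
Proof. by rewrite -(addr0 (a *: x)) dotPl dot0l addr0. Qed.

Lemma dotBl x y z : dot (x - y) z = dot x z - dot y z.
Proof. by rewrite dotDl -scaleN1r dotZl mulN1r. Qed.

Lemma dotDr x y z : dot z (x + y) = dot z x + dot z y.
Proof. by rewrite !(dotC z) dotDl. Qed.

Lemma dotBr x y z : dot z (x - y) = dot z x - dot z y.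
Proof. by rewrite !(dotC z) dotBl. Qed.

Lemma dotZr a x z : dot z (a *: x) = a * dot z x.
Proof. by rewrite !(dotC z) dotZl. Qed.

Lemma dot0r z : dot z 0 = 0. Proof. by rewrite dotC dot0l. Qed.

Lemma dot_suml I (r : seq I) (P : pred I) (F : I -> U) z :
  dot (\sum_(i <- r | P i) F i) z = \sum_(i <- r | P i) dot (F i) z.
Proof.
elim/big_rec2: _ => [|i x y _ <-]; first exact: dot0l.
by rewrite dotDl.
Qed.

Lemma dot_ge0 x : 0 <= dot x x.
Proof. by have [->|/dot_gt0/ltW//] := eqVneq x 0; rewrite dot0l. Qed.

Lemma dot_eq0 x : (dot x x == 0) = (x == 0).
Proof. by have [->|/dot_gt0/gt_eqF//] := eqVneq x 0; rewrite dot0l eqxx. Qed.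

Lemma dot_linear z : linear (fun x => dot x z : R^o).
Proof. by move=> a x y; rewrite dotPl. Qed.

Definition dotfun z : 'Hom(U, R^o) :=
  linfun (HB.pack_for {linear U -> R^o} (fun x => dot x z : R^o)
    (GRing.isLinear.Build _ _ _ _ (fun x => dot x z : R^o) (dot_linear z))).

Lemma dotfunE z x : dotfun z x = dot x z. Proof. by rewrite lfunE. Qed.

(** How the bound on adjoints is used: a vector [x] that pairs with [y] as it
    pairs with itself is orthogonal to [y - x]. *)
Lemma dot_le_of_dot_eq x y : dot x x = dot x y -> dot x x <= dot y y.
Proof.
move=> xy; have := dot_ge0 (y - x).
by rewrite dotBl !dotBr (dotC y x) -xy subrr subr0 subr_ge0.
Qed.

End InnerProduct.

Lemma inner_product_subvs (R : realFieldType) (U : vectType R)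
    (dot : U -> U -> R) (S : {vspace U}) : inner_product dot ->
  inner_product (fun x y : subvs_of S => dot (vsval x) (vsval y)).
Proof.
move=> dotP; split=> [a x y z|x y|x x0].
- by rewrite linearP /= dotPl.
- by case: dotP.
- apply: dot_gt0 dotP _ _; apply: contra_neq x0 => x0.
  by apply: val_inj; rewrite /= x0.
Qed.

(** The adjoint of the inclusion of [S] has kernel the orthogonal complement of
    [S], so when this is trivial the whole space embeds into [S]. *)
Lemma orthogonal_trivial_full (R : realFieldType) (U : vectType R)
    (dot : U -> U -> R) (S : {vspace U}) : inner_product dot ->
  (forall x, (forall y, y \in S -> dot x y = 0) -> x = 0) -> S = fullv.
Proof.
move=> dotP S0.
have [dl ds _] := dotP; have [dl' ds' _] := inner_product_subvs S dotP.
have d0 (x : subvs_of S) : dot (vsval x) (vsval x) = 0 -> x = 0.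
  by move/eqP; rewrite (dot_eq0 dotP) => /eqP x0; apply: val_inj.
have adj := @adjointP R (subvs_of S) U _ _ dl' ds' d0 dl ds (linfun vsval).
set g := adjoint _ _ _ in adj.
have ker0 : lker g == 0%VS.
  rewrite -subv0; apply/subvP => x; rewrite memv_ker memv0 => /eqP gx.
  apply/eqP; apply: S0 => y yS; have := adj (vsproj S y) x.
  rewrite gx lfunE /= vsprojK //.
  by rewrite (dot0r dotP) (ds x y).
apply/eqP; rewrite eqEdim subvf /=.
rewrite -(limg_dim_eq (f := g)) ?(eqP ker0) ?capv0 //.
by apply: leq_trans (dimvS (subvf _)) _; rewrite dimvf.
Qed.

(** * Orthogonal eigenbases *)

Section Spectral.
Context {R : realType}.

(** The real and imaginary parts [u] and [v] of an eigenvector of [A] over the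
    complex numbers, for the eigenvalue [a + i b]. *)
Lemma complex_eigenvector n (A : 'M[R]_n) : (0 < n)%N ->
  exists a b (u v : 'rV[R]_n), [/\ u *m A = a *: u - b *: v,
    v *m A = a *: v + b *: u & (u != 0) || (v != 0)].
Proof.
move=> n0; pose AC := map_mx (fun x : R => x%:C%C) A.
have [[a b] /eigenvalueP[w wA w0]] := eigenvalue_closed AC n0.
exists a, b, (map_mx (@complex.Re R) w), (map_mx (@complex.Im R) w).
have wE j : \sum_k w 0 k * (A k j)%:C%C = (a +i* b)%C * w 0 j.
  have /rowP/(_ j) := wA; rewrite !mxE => <-.
  by apply: eq_bigr => k _; rewrite mxE.
split.
- apply/rowP => j; rewrite !mxE; have /(congr1 (@complex.Re R)) := wE j.
  rewrite (raddf_sum (@complex.Re R : Rcomplex R -> R)) /=.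
  case: (w 0 j) => x y /= <-; apply: eq_bigr => k _; rewrite !mxE.
  by case: (w 0 k) => s t /=; rewrite mulr0 subr0.
- apply/rowP => j; rewrite !mxE; have /(congr1 (@complex.Im R)) := wE j.
  rewrite (raddf_sum (@complex.Im R : Rcomplex R -> R)) /=.
  case: (w 0 j) => x y /= <-; apply: eq_bigr => k _; rewrite !mxE.
  by case: (w 0 k) => s t /=; rewrite mulr0 add0r.
- rewrite -negb_and; apply: contraNN w0 => /andP[/eqP/rowP re0 /eqP/rowP im0].
  apply/eqP/rowP => j; have := re0 j; have := im0 j; rewrite !mxE.
  by case: (w 0 j) => x y /= -> ->.
Qed.

Definition selfadjoint (U : vectType R) (dot : U -> U -> R) (f : 'End(U)) :=
  forall x y, dot (f x) y = dot x (f y).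

(** With [x] and [y] the real and imaginary parts of a complex eigenvector for
    [a + i b], comparing [dot (f x) y] with [dot x (f y)] gives
    [b * (dot x x + dot y y) = 0]. Hence [b = 0], and whichever of [x] and [y]
    is nonzero is a real eigenvector. *)
Lemma selfadjoint_eigenvector (U : vectType R) (dot : U -> U -> R)
    (f : 'End(U)) :
  inner_product dot -> selfadjoint dot f -> (0 < \dim {:U})%N ->
  exists a e, e != 0 /\ f e = a *: e.
Proof.
move=> dotP fS n0; have [_ dotC _] := dotP.
have eB := vbasisP {:U}; set e := vbasis {:U} in eB.
have [a [b [u [v [uE vE uv0]]]]] := complex_eigenvector (passmx.mxof e e f) n0.
pose x := passmx.vecof e u; pose y := passmx.vecof e v.
have fx : f x = a *: x - b *: y.
  by rewrite (passmx.hom_vecof _ eB) uE linearB !linearZ.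
have fy : f y = a *: y + b *: x.
  by rewrite (passmx.hom_vecof _ eB) vE linearD !linearZ.
have xy0 : (x != 0) || (y != 0) by rewrite !(passmx.vecof_eq0 eB).
have b0 : b = 0.
  have pos : 0 < dot x x + dot y y.
    by case/orP: xy0 => /(dot_gt0 dotP) ?; have := dot_ge0 dotP x;
      have := dot_ge0 dotP y; lra.
  have h : b * (dot x x + dot y y) = 0.
    have := fS x y; rewrite fx fy (dotBl dotP) (dotDr dotP) !(dotZl dotP).
    by rewrite !(dotZr dotP); lra.
  by move/eqP: h; rewrite mulf_eq0 (gt_eqF pos) orbF => /eqP.
move: fx fy; rewrite b0 !scale0r subr0 addr0 => fx fy.
by case/orP: xy0; [exists a, x | exists a, y].
Qed.

(** Stated for an invariant subspace [S], so that induction on the dimension can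
    pass to the vectors of [S] orthogonal to an eigenvector. *)
Lemma orthogonal_eigenbasis (U : vectType R) (dot : U -> U -> R) (f : 'End(U))
    (S : {vspace U}) :
  inner_product dot -> selfadjoint dot f -> (f @: S <= S)%VS ->
  exists X : seq U, [/\ size X = \dim S, {subset X <= S},
    pairwise (fun x y => dot x y == 0) X &
    forall x, x \in X -> x != 0 /\ exists a, f x = a *: x].
Proof.
move=> dotP fS; have [_ dotC _] := dotP.
have [m] := ubnP (\dim S); elim: m S => // m IH S /ltnSE leSm stS.
have [S0|S0] := posnP (\dim S); first by exists [::]; rewrite S0.
have stSv x : x \in S -> f x \in S.
  by move=> xS; apply: (subvP stS); exact: memv_img.
pose g : 'End(subvs_of S) := linfun (vsproj S \o f \o vsval).
have gE (x : subvs_of S) : vsval (g x) = f (vsval x).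
  by rewrite lfunE /= vsprojK // stSv // subvsP.
have [||a [e' [e'0 ge']]] :=
  @selfadjoint_eigenvector _ _ g (inner_product_subvs S dotP).
- by move=> x y; rewrite !gE fS.
- by rewrite dimvf.
pose e := vsval e'; have eS : e \in S := subvsP e'.
have e0 : e != 0.
  by apply: contra_neq e'0 => e0; apply: val_inj; rewrite /= -/e e0.
have fe : f e = a *: e by rewrite -gE ge' linearZ.
pose S' := (S :&: lker (dotfun dotP e))%VS.
have S'P x : (x \in S') = (x \in S) && (dot x e == 0).
  by rewrite memv_cap memv_ker dotfunE.
have dimS : \dim S = (\dim S').+1.
  apply/eqP; rewrite -(limg_ker_dim (dotfun dotP e) S) -addn1 eqn_add2l.
  rewrite eqn_leq; apply/andP; split.
    by apply: leq_trans (dimvS (subvf _)) _; rewrite dimvf.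
  rewrite lt0n dimv_eq0; apply/eqP => im0.
  have : dotfun dotP e e \in (dotfun dotP e @: S)%VS by exact: memv_img.
  by rewrite im0 memv0 dotfunE (dot_eq0 dotP) (negPf e0).
have [||X [sX XS' Xp Xe]] := IH S'.
- by rewrite -ltnS -dimS.
- apply/subvP => _ /memv_imgP[x + ->]; rewrite !S'P => /andP[xS /eqP xe].
  by rewrite stSv //= fS fe (dotZr dotP) xe mulr0.
exists (e :: X); split=> /=; first by rewrite sX dimS.
- by move=> x /predU1P[->//|/XS']; rewrite S'P => /andP[].
- rewrite Xp andbT; apply/allP => x /XS'; rewrite S'P => /andP[_].
  by rewrite dotC.
- by move=> x /predU1P[->|/Xe//]; split => //; exists a.
Qed.

Lemma pairwise_dot0_free (U : vectType R) (dot : U -> U -> R) (X : seq U) :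
  inner_product dot -> pairwise (fun x y => dot x y == 0) X ->
  {in X, forall x, x != 0} -> free X.
Proof.
move=> dotP; elim: X => [|x X IH] /=; first by rewrite nil_free.
move=> /andP[/allP xX XX] X0; rewrite free_cons IH //; last first.
  by move=> y yX; apply: X0; rewrite inE yX orbT.
rewrite andbT; apply/negP => xsp.
have : (<<X>> <= lker (dotfun dotP x))%VS.
  apply/span_subvP => y yX; rewrite memv_ker dotfunE.
  by have [_ -> _] := dotP; exact: xX.
move/subvP/(_ _ xsp); rewrite memv_ker dotfunE (dot_eq0 dotP).
by rewrite (negPf (X0 x _)) // mem_head.
Qed.

(** * The spectrum of a diagonalizable endomorphism *)

Lemma sorted_flatten_nseq (m : R -> nat) (r : seq R) : sorted <%R r ->
  sorted <=%R (flatten [seq nseq (m a) a | a <- r]).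
Proof.
elim: r => [//|a r IH] /= ar.
have lt_ar : all (> a) r by exact: order_path_min lt_trans ar.
have {IH} := IH (path_sorted ar); set s := flatten _ => ss.
have le_as : all (>= a) s.
  apply/allP => x /flattenP[_ /mapP[b br ->]].
  by rewrite mem_nseq => /andP[_ /eqP ->]; rewrite ltW //; exact: (allP lt_ar).
elim: (m a) => [//|n IHn] /=; rewrite path_sortedE; last exact: le_trans.
by rewrite IHn andbT all_cat le_as all_nseq lexx orbT.
Qed.

Lemma count_flatten_nseq (m : R -> nat) (r : seq R) a : uniq r ->
  count_mem a (flatten [seq nseq (m b) b | b <- r]) = ((a \in r) * m a)%N.
Proof.
elim: r => [//|b r IH] /= /andP[br ur].
rewrite count_cat count_nseq /= IH // inE eq_sym; have [<-|//] := eqVneq b a.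
by rewrite (negPf br) addn0.
Qed.

Lemma char_poly_similar n (A B P Q : 'M[R]_n) : Q *m P = 1%:M ->
  A = P *m B *m Q -> char_poly A = char_poly B.
Proof.
move=> QP ->; have PQ := mulmx1C QP; rewrite /char_poly.
have PQX : map_mx polyC P *m map_mx polyC Q = 1%:M.
  by rewrite -map_mxM PQ map_mx1.
have -> : char_poly_mx (P *m B *m Q) =
    map_mx polyC P *m char_poly_mx B *m map_mx polyC Q.
  rewrite /char_poly_mx mulmxBr mulmxBl !map_mxM /= mul_mx_scalar -scalemxAl.
  by rewrite PQX scale_scalar_mx mulr1.
by rewrite !det_mulmx mulrAC -det_mulmx PQX det1 mul1r.
Qed.

Section Eigenbasis.
Variables (U : vectType R) (f : 'End(U)).
Variables (X : (\dim {:U}).-tuple U) (a : 'I_(\dim {:U}) -> R).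
Hypothesis XB : basis_of {:U} X.
Hypothesis fX : forall i : 'I_(\dim {:U}), f X`_i = a i *: X`_i.

(** Changing from the reference basis to the eigenbasis conjugates the matrix of
    [f] to a diagonal one. *)
Lemma charpoly_eigenbasis : charpoly f = \prod_i ('X - (a i)%:P).
Proof.
have eB := vbasisP {:U}; set e := vbasis {:U} in eB.
pose D := mxof X X f.
have DE i j : D i j = a i *+ (i == j).
  rewrite !mxE /= vecof_delta fX linearZ /= coord_free ?(basis_free XB) //.
  by rewrite mulr_natr eq_sym.
have -> : charpoly f = char_poly D.
  rewrite /charpoly -/e.
  apply: (@char_poly_similar _ _ _ (mxof e X \1) (mxof X e \1)).
    by rewrite -mxof_comp // comp_lfun1l mxof1 // (basis_free XB).
  by rewrite -!mxof_comp // comp_lfun1l comp_lfun1r.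
rewrite char_poly_trig; first by apply: eq_bigr => i _; rewrite DE eqxx.
by apply/is_trig_mxP => i j ij; rewrite DE -val_eqE ltn_eqF.
Qed.

(** So the spectrum is the sorted list of the [a i]: the multiplicity of [x] as
    a root of the product is its number of occurrences among them. *)
Lemma spectrum_eigenbasis :
  sorted <=%R (spectrum f) /\
  perm_eq (spectrum f) [seq a i | i : 'I_(\dim {:U})].
Proof.
have rS : sorted <%R (rootsR (charpoly f)) by exact: sorted_roots.
split; first exact: sorted_flatten_nseq.
have pE : charpoly f = \prod_(x <- [seq a i | i : 'I_(\dim {:U})]) ('X - x%:P).
  by rewrite charpoly_eigenbasis big_map big_enum.
apply/allP => x _ /=; apply/eqP.
rewrite count_flatten_nseq; last exact: sorted_uniq lt_trans ltxx _ rS.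
have p0 : charpoly f != 0 by rewrite pE monic_neq0 // monic_prod_XsubC.
have := roots_on_rootsR p0 x; rewrite in_itv /= => <-.
have [rx|rx] := boolP (root _ _); first by rewrite mul1n pE mu_prod_XsubC.
by rewrite mul0n -mu_prod_XsubC -pE mupNroot.
Qed.

Definition eigenspan (P : pred 'I_(\dim {:U})) : {vspace U} :=
  <<[seq X`_(i : 'I_(\dim {:U})) | i <- enum P]>>.

(** Only the upper bound is immediate; applied to [P] and to its complement, it
    gives the lower one, as the two spans add up to the whole space. *)
Lemma dim_eigenspan P : \dim (eigenspan P) = #|P|.
Proof.
have le Q : (\dim (eigenspan Q) <= #|Q|)%N.
  by rewrite cardE -(size_map (fun i : 'I_(\dim {:U}) => X`_i)) dim_span.
apply/eqP; rewrite eqn_leq le /=.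
rewrite -(leq_add2r #|predC P|) cardC card_ord.
have full : (fullv <= eigenspan P + eigenspan (predC P))%VS.
  apply/subvP => x _; rewrite (coord_basis XB (memvf x)) memv_suml // => i _.
  apply: memvZ; have [Pi|Pi] := boolP (P i).
    apply: (subvP (addvSl _ _)); apply/memv_span/map_f.
    by rewrite mem_enum.
  apply: (subvP (addvSr _ _)); apply/memv_span/map_f.
  by rewrite mem_enum inE.
apply: leq_trans (dimvS full) _; apply: leq_trans (dimv_add_leqif _ _) _.
by rewrite leq_add2l le.
Qed.

Lemma coord_eigenspan P x i : x \in eigenspan P -> ~~ P i -> coord X i x = 0.
Proof.
move=> xP Pi; set Y := [seq X`_(j : 'I__) | j <- enum P] in xP *.
have -> : x = \sum_j coord (in_tuple Y) j x *: Y`_j by exact: coord_span.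
rewrite linear_sum big1 // => j _; rewrite linearZ /=.
have /mapP[l + ->] : Y`_j \in Y by rewrite mem_nth.
rewrite mem_enum coord_free ?(basis_free XB) //.
case: eqP => [il|_ _]; last by rewrite mulr0.
by rewrite il unfold_in (negPf Pi).
Qed.

End Eigenbasis.

(** * The min-max principle *)

Section MinMax.
Variables (U : vectType R) (dot : U -> U -> R) (f : 'End(U)).
Hypothesis dotP : inner_product dot.
Hypothesis fS : selfadjoint dot f.

Lemma eigenbasis_ex :
  exists (X : (\dim {:U}).-tuple U) (a : 'I_(\dim {:U}) -> R),
  [/\ basis_of {:U} X, forall i : 'I_(\dim {:U}), f X`_i = a i *: X`_i
    & forall i j : 'I_(\dim {:U}), i != j -> dot X`_i X`_j = 0].
Proof.
have [_ dotC _] := dotP.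
have [X [sX _ Xp Xe]] := orthogonal_eigenbasis dotP fS (subvf _).
have Xi (i : 'I_(\dim {:U})) : X`_i \in X by rewrite mem_nth // sX.
have /choice [a aP] : forall i : 'I_(\dim {:U}), exists a, f X`_i = a *: X`_i.
  by move=> i; have [] := Xe _ (Xi i).
have fX : free X by apply: (pairwise_dot0_free dotP Xp) => x /Xe[].
exists (Tuple (introT eqP sX)), a; split => //=.
  by rewrite basisEfree fX subvf /= sX.
have lt (i j : 'I_(\dim {:U})) : (i < j)%N -> dot X`_i X`_j = 0.
  move=> ij; apply/eqP; have /(pairwiseP 0) := Xp.
  by apply => //; rewrite inE sX.
move=> i j; rewrite -val_eqE neq_ltn => /orP[/lt//|/lt].
by rewrite dotC.
Qed.

Lemma dot_eigenbasis (X : (\dim {:U}).-tuple U) (a : 'I_(\dim {:U}) -> R) x :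
  basis_of {:U} X -> (forall i : 'I_(\dim {:U}), f X`_i = a i *: X`_i) ->
  (forall i j : 'I_(\dim {:U}), i != j -> dot X`_i X`_j = 0) ->
  dot x x = \sum_i coord X i x ^+ 2 * dot X`_i X`_i /\
  dot (f x) x = \sum_i a i * (coord X i x ^+ 2 * dot X`_i X`_i).
Proof.
move=> XB fX Xo; have [_ dotC _] := dotP.
have xX (i : 'I_(\dim {:U})) : dot X`_i x = coord X i x * dot X`_i X`_i.
  rewrite {1}(coord_basis XB (memvf x)) dotC (dot_suml dotP) (bigD1 i) //=.
  rewrite big1 ?addr0; first by rewrite (dotZl dotP).
  by move=> j ji; rewrite (dotZl dotP) Xo ?mulr0.
split.
  rewrite {1}(coord_basis XB (memvf x)) (dot_suml dotP); apply: eq_bigr => i _.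
  by rewrite (dotZl dotP) xX expr2 mulrA.
rewrite {1}(coord_basis XB (memvf x)) linear_sum (dot_suml dotP) /=.
apply: eq_bigr => i _; rewrite linearZ /= fX !(dotZl dotP) xX expr2; ring.
Qed.

(** One half of the min-max principle. Were the [k]-th eigenvalue greater than
    [mu], fewer than [k] eigenvalues would be at most [mu], so [S] would meet
    the span of the eigenvectors of eigenvalue greater than [mu]; there the
    Rayleigh quotient exceeds [mu]. *)
Lemma kth_eigenvalue_le k (S : {vspace U}) mu : (0 < k <= \dim S)%N ->
  (forall x, x \in S -> dot (f x) x <= mu * dot x x) ->
  (kth_eigenvalue k f <= mu%:E)%E.
Proof.
move=> /andP[k0 kS] Smu; have [X [a [XB fX Xo]]] := eigenbasis_ex.
have [ss sp] := spectrum_eigenbasis XB fX.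
have sz : size (spectrum f) = \dim {:U}.
  by rewrite (perm_size sp) size_map -cardE card_ord.
rewrite /kth_eigenvalue k0 sz (leq_trans kS (dimvS (subvf _))) lee_fin.
rewrite leNgt; apply/negP => mulk.
pose P := [pred i | mu < a i].
have cP : (\dim {:U} - #|P| < k)%N.
  rewrite -[X in (X - _)%N]card_ord -(cardC P) addKn.
  have -> : #|predC P| = count (<= mu) (spectrum f).
    rewrite (permP sp) count_map cardE size_filter -enumT; apply: eq_count => i.
    by rewrite !inE /= leNgt.
  rewrite ltnNge; apply/negP => kc.
  have := @nth_count_le _ _ mu 0 (spectrum f) k.-1 ss.
  by rewrite prednK // => /(_ kc); rewrite leNgt mulk.
have : (S :&: eigenspan X P)%VS != 0%VS.
  rewrite -dimv_eq0 -lt0n -(ltn_add2l (\dim (S + eigenspan X P))) dimv_sum_cap.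
  rewrite dim_eigenspan // addn0.
  apply: leq_ltn_trans (dimvS (subvf _)) _.
  have Pn : (#|P| <= \dim {:U})%N.
    by rewrite -[X in (_ <= X)%N]card_ord max_card.
  move: cP; rewrite ltn_subLR // => {}cP.
  by rewrite addnC (leq_trans cP) // leq_add2l.
rewrite -vpick0; set x := vpick _ => x0.
have : x \in (S :&: eigenspan X P)%VS by exact: memv_pick.
rewrite memv_cap => /andP[/Smu + xP].
have [-> ->] := dot_eigenbasis x XB fX Xo.
rewrite -subr_le0 mulr_sumr -sumrB => le0.
pose c (i : 'I_(\dim {:U})) := coord X i x ^+ 2 * dot X`_i X`_i.
have c_ge0 i : 0 <= c i by rewrite mulr_ge0 ?sqr_ge0 // (dot_ge0 dotP).
have cNP i : ~~ P i -> c i = 0.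
  by move=> Pi; rewrite /c (coord_eigenspan XB xP Pi) expr0n mul0r.
have t_ge0 i : 0 <= a i * c i - mu * c i.
  rewrite -mulrBl; have [Pi|/cNP ->] := boolP (P i); last by rewrite mulr0.
  by rewrite mulr_ge0 // subr_ge0 ltW.
have t0 : \sum_i (a i * c i - mu * c i) = 0.
  by apply/eqP; rewrite eq_le le0 sumr_ge0.
have c0 i : c i = 0.
  have [Pi|/cNP //] := boolP (P i).
  have /eqP : a i * c i - mu * c i = 0.
    by apply: (psumr_eq0P _ t0).
  by rewrite -mulrBl mulf_eq0 subr_eq0 gt_eqF //= => /eqP.
have [xx _] := dot_eigenbasis x XB fX Xo.
move: x0; rewrite -(dot_eq0 dotP) xx big1 ?eqxx // => i _; exact: c0.
Qed.

(** The other half: the span of the eigenvectors of eigenvalue at most [l]. *)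
Lemma kth_eigenvalue_witness k l : kth_eigenvalue k f = l%:E ->
  exists S : {vspace U}, (k <= \dim S)%N /\
    forall x, x \in S -> dot (f x) x <= l * dot x x.
Proof.
rewrite /kth_eigenvalue; case: ifP => // /andP[k0 ks] [lE].
have [X [a [XB fX Xo]]] := eigenbasis_ex.
have [ss sp] := spectrum_eigenbasis XB fX.
pose P := [pred i | a i <= l]; exists (eigenspan X P); split.
  rewrite dim_eigenspan //.
  have -> : #|P| = count (<= l) (spectrum f).
    rewrite (permP sp) count_map cardE size_filter -enumT; exact: eq_count.
  rewrite leqNgt; apply/negP => ck.
  have := @nth_count_gt _ _ l 0 (spectrum f) k.-1 ss.
  by rewrite prednK // ks andbT -ltnS prednK // => /(_ ck); rewrite lE ltxx.
move=> x xP; have [-> ->] := dot_eigenbasis x XB fX Xo.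
rewrite mulr_sumr; apply: ler_sum => i _.
have [Pi|Pi] := boolP (P i).
  by rewrite ler_wpM2r // mulr_ge0 ?sqr_ge0 // (dot_ge0 dotP).
by rewrite (coord_eigenspan XB xP Pi) expr0n mul0r !mulr0.
Qed.

End MinMax.

(** A subspace on which the Rayleigh quotient of [f1] is at most [l] pulls back
    along [pi], within [G], to one of at least the same dimension. As [f1] is
    nonnegative, so is [l], and lengthening the vectors while decreasing the
    quadratic form keeps the Rayleigh quotient at most [l]. Asking [pi] to be
    onto from a subspace [G] spares the choice of a linear section. *)
Lemma kth_eigenvalue_compare (U1 U2 : vectType R) (dot1 : U1 -> U1 -> R)
    (dot2 : U2 -> U2 -> R) (f1 : 'End(U1)) (f2 : 'End(U2))
    (pi : 'Hom(U2, U1)) (G : {vspace U2}) k :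
  inner_product dot1 -> inner_product dot2 ->
  selfadjoint dot1 f1 -> selfadjoint dot2 f2 ->
  (forall x, 0 <= dot1 (f1 x) x) ->
  (pi @: G = fullv)%VS ->
  (forall z, z \in G -> dot2 (f2 z) z <= dot1 (f1 (pi z)) (pi z)) ->
  (forall z, z \in G -> dot1 (pi z) (pi z) <= dot2 z z) ->
  (0 < k)%N -> (kth_eigenvalue k f2 <= kth_eigenvalue k f1)%E.
Proof.
move=> P1 P2 S1 S2 f1ge0 piG le12 le21 k0.
case E : (kth_eigenvalue k f1) => [l||]; last 2 first.
- by rewrite leey.
- by move: E; rewrite /kth_eigenvalue; case: ifP.
have [S [kS Sl]] := kth_eigenvalue_witness P1 S1 E.
pose S' := (G :&: (pi @^-1: S))%VS.
have piS' : (pi @: S' = S)%VS.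
  apply/vspaceP => x; apply/memv_imgP/idP => [[z + ->]|xS].
    by rewrite memv_cap -memv_preim => /andP[].
  have : x \in (pi @: G)%VS by rewrite piG memvf.
  case/memv_imgP => z zG xE; exists z => //.
  by rewrite memv_cap zG -memv_preim -xE.
apply: (@kth_eigenvalue_le _ _ _ P2 S2 k S').
  rewrite k0 (leq_trans kS) // -piS' -(limg_ker_dim pi S') leq_addl //.
have [x [xS x0]] : exists x, x \in S /\ x != 0.
  exists (vpick S); rewrite memv_pick vpick0 -dimv_eq0 -lt0n; split=> //.
  exact: leq_trans kS.
have l0 : 0 <= l.
  have := le_trans (f1ge0 x) (Sl _ xS).
  by rewrite pmulr_lge0 // (dot_gt0 P1).
move=> z; rewrite memv_cap -memv_preim => /andP[zG /Sl le].
apply: le_trans (le12 _ zG) _; apply: le_trans le _.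
by rewrite ler_wpM2l // le21.
Qed.

End Spectral.

(** * Chain spaces *)

Section Complexes.
Context {R : realType} {d : Order.disp_t} {V : finOrderType d}.
Implicit Types (K L : complex R V) (q : nat) (c : chains R V).

Lemma chainP q K c :
  reflect (forall s, s \notin qsimplices q K -> c s = 0) (c \in chain q K).
Proof.
apply: (iffP idP) => [cK s|c0]; first exact: chain_supp.
have -> : c = \sum_(s in qsimplices q K) c s *: osimplex s.
  apply/ffunP => t; rewrite sum_ffunE.
  have [tK|tK] := boolP (t \in qsimplices q K).
    rewrite (bigD1 t) //= big1 => [|s /andP[_ /negPf st]].
      by rewrite !ffunE eqxx addr0 /GRing.scale /= mulr1.
    by rewrite !ffunE eq_sym st scaler0.
  rewrite c0 // big1 // => s sK; rewrite !ffunE; case: eqP => [ts|_].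
    by rewrite ts sK in tK.
  by rewrite scaler0.
apply: memv_suml => s sK; apply/memvZ/memv_span/(map_f osimplex).
by rewrite mem_enum.
Qed.

Lemma qsimplices_pair q K L : simplicial_pair K L ->
  {subset qsimplices q K <= qsimplices q L}.
Proof.
move=> [/fintype.subsetP KL _] s; rewrite !finset.inE => /andP[/KL -> ->] //.
Qed.

Lemma qsimplices_pairI q K L : simplicial_pair K L ->
  (qsimplices q L :&: qsimplices q K = qsimplices q K)%SET.
Proof.
by move=> KL; apply/finset.setIidPr/fintype.subsetP; exact: qsimplices_pair.
Qed.

Lemma chain_pair q K L : simplicial_pair K L -> (chain q K <= chain q L)%VS.
Proof.
move=> KL; apply/subvP => c /chainP c0; apply/chainP => s sL; apply: c0.
by apply: contraNN sL => /(qsimplices_pair KL).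
Qed.

Lemma cdot_pair q K L c c' : simplicial_pair K L -> c \in chain q K ->
  cdot q L c c' = cdot q K c c'.
Proof.
move=> KL /chainP c0; rewrite /cdot.
rewrite (big_setID (qsimplices q K)) /= [X in _ + X]big1 ?addr0; last first.
  by move=> s; rewrite finset.inE => /andP[/c0 -> _]; rewrite !mul0r.
rewrite (qsimplices_pairI q KL).
apply: eq_bigr => s sK; have [_ -> //] := KL.
by move: sK; rewrite finset.inE => /andP[].
Qed.

Lemma cdot_ge0 q K c : 0 <= cdot q K c c.
Proof.
apply: sumr_ge0 => s; rewrite finset.inE => /andP[/weight_gt0/ltW w0 _].
by rewrite divr_ge0 // -expr2 sqr_ge0.
Qed.

Lemma cdot_pair_le q K L c :
  simplicial_pair K L -> cdot q K c c <= cdot q L c c.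
Proof.
move=> KL; rewrite /cdot [leRHS](big_setID (qsimplices q K)) /=.
rewrite (qsimplices_pairI q KL).
rewrite (eq_bigr (fun s => c s * c s / weight L s)); last first.
  move=> s sK; have [_ -> //] := KL.
  by move: sK; rewrite finset.inE => /andP[].
rewrite lerDl sumr_ge0 // => s; rewrite !finset.inE => /and3P[_ sL _].
by rewrite divr_ge0 ?(ltW (weight_gt0 sL)) // -expr2 sqr_ge0.
Qed.

Lemma cdot_inner_product q K (S : {vspace chains R V}) : (S <= chain q K)%VS ->
  inner_product (fun x y : subvs_of S => cdot q K (vsval x) (vsval y)).
Proof.
move=> /subvP SK; split=> [a x y z|x y|x x0].
- by rewrite linearP /= cdotPl.
- exact: cdotC.
- rewrite lt_neqAle cdot_ge0 andbT eq_sym; apply: contra_neq x0 => x0.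
  by apply/val_inj/(cdot_def _ x0)/SK/subvsP.
Qed.

Lemma chain_inner_product q K :
  inner_product (fun x y : subvs_of (chain q K) => cdot q K (vsval x) (vsval y)).
Proof. exact: cdot_inner_product (subvv _). Qed.

Lemma pchain_inner_product q K L :
  inner_product (fun x y : subvs_of (pchain q K L) =>
    cdot q.+1 L (vsval x) (vsval y)).
Proof. by apply: cdot_inner_product; exact: capvSl. Qed.

(** * Up-Laplacians and their monotonicity *)

Lemma up_laplacianE q K L (x y : subvs_of (chain q K)) :
  cdot q K (vsval (up_laplacian q K L x)) (vsval y) =
  cdot q.+1 L (vsval (pcoboundary q K L x)) (vsval (pcoboundary q K L y)).
Proof. by rewrite comp_lfunE pcoboundaryP. Qed.

Lemma up_laplacian_selfadjoint q K L :
  selfadjoint (fun x y : subvs_of (chain q K) => cdot q K (vsval x) (vsval y))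
    (up_laplacian q K L).
Proof. by move=> x y; rewrite up_laplacianE cdotC -up_laplacianE cdotC. Qed.

Lemma pchainP q K L c :
  (c \in pchain q K L) = (c \in chain q.+1 L) && (boundary c \in chain q K).
Proof. by rewrite memv_cap memv_preim. Qed.

(** The adjunction, for chains that are not packed into their subspace. *)
Lemma pcoboundary_boundary q K L c (y : subvs_of (chain q K)) :
  c \in pchain q K L ->
  cdot q.+1 L c (vsval (pcoboundary q K L y)) = cdot q K (boundary c) (vsval y).
Proof. by move=> cP; rewrite -[c](vsprojK cP) -pcoboundaryP pboundaryE. Qed.

(** On the chains of a complex containing [K], the orthogonal projection onto
    [chain q K]. *)
Definition restrict_chain q K c : chains R V :=
  [ffun s => if s \in qsimplices q K then c s else 0].

Lemma restrict_chain_linear q K : linear (restrict_chain q K).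
Proof.
move=> a x y; apply/ffunP => s; rewrite !ffunE.
by case: ifP => _ //; rewrite scaler0 addr0.
Qed.

HB.instance Definition _ q K := GRing.isLinear.Build R (chains R V) (chains R V)
  _ (restrict_chain q K) (restrict_chain_linear q K).

Lemma restrict_chain_mem q K c : restrict_chain q K c \in chain q K.
Proof. by apply/chainP => s /negPf sK; rewrite ffunE sK. Qed.

Lemma restrict_chain_id q K c : c \in chain q K -> restrict_chain q K c = c.
Proof.
by move=> /chainP c0; apply/ffunP => s; rewrite ffunE; case: ifPn => // /c0.
Qed.

Lemma cdot_restrict q K c c' :
  cdot q K (restrict_chain q K c) c' = cdot q K c c'.
Proof. by apply: eq_bigr => s sK; rewrite ffunE sK. Qed.

(** The vectors of [chain q K2] over a given [x] form the translate of
    [x] by the kernel of the restriction to [K1], so it suffices that the image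
    under the coboundary [T] of this kernel and [pchain q K1 L] together span
    [pchain q K2 L]. A vector [w] orthogonal to the former has a boundary
    orthogonal to all the chains of [K2] that vanish on [K1]: this boundary is
    thus a chain of [K1], and [w] is in [pchain q K1 L]. Being orthogonal to
    that space too, [w] is zero. *)
Lemma pcoboundary_lift q K1 K2 L (x : subvs_of (chain q K1)) :
  simplicial_pair K1 K2 ->
  exists z : subvs_of (chain q K2),
    vsval (pcoboundary q K2 L z) \in pchain q K1 L /\
    restrict_chain q K1 (vsval z) = vsval x.
Proof.
move=> KK; pose W := subvs_of (pchain q K2 L).
pose T := pcoboundary q K2 L.
pose r : 'Hom(subvs_of (chain q K2), chains R V) :=
  linfun (restrict_chain q K1 \o vsval).
pose W1 : {vspace W} := (linfun vsval @^-1: pchain q K1 L)%VS.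
have W1P (w : W) : (w \in W1) = (vsval w \in pchain q K1 L).
  by rewrite -memv_preim lfunE.
have WP : inner_product (fun x y : W => cdot q.+1 L (vsval x) (vsval y)).
  exact: pchain_inner_product.
have full : (T @: lker r + W1)%VS = fullv.
  apply: (orthogonal_trivial_full WP) => w w0.
  have wK2 : boundary (vsval w) \in chain q K2.
    by have := subvsP w; rewrite pchainP => /andP[].
  have bw : boundary (vsval w) \in chain q K1.
    set b := boundary _ in wK2 *.
    have y0 : b - restrict_chain q K1 b \in chain q K2.
      by rewrite memvB // (subvP (chain_pair _ KK)) // restrict_chain_mem.
    suff /eqP : b - restrict_chain q K1 b = 0.
      by rewrite subr_eq0 => /eqP ->; exact: restrict_chain_mem.
    have yr : vsproj (chain q K2) (b - restrict_chain q K1 b) \in lker r.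
      rewrite memv_ker lfunE /= vsprojK // linearB /=.
      by rewrite (restrict_chain_id (restrict_chain_mem _ _ _)) subrr.
    have := w0 _ (subvP (addvSl _ W1) _ (memv_img T yr)).
    rewrite pcoboundary_boundary ?subvsP // vsprojK // -/b => by0.
    (* The chain in [y0] is orthogonal to [b] by [by0], and to the restriction
       of [b] because it vanishes on [K1]. *)
    apply: (cdot_def y0).
    have := cdotPl q K2 (-1) (restrict_chain q K1 b) b (b - restrict_chain q K1 b).
    rewrite scaleN1r addrC => ->; rewrite by0 addr0.
    rewrite (cdot_pair _ KK (restrict_chain_mem _ _ _)).
    rewrite cdotC -cdot_restrict linearB /=.
    rewrite (restrict_chain_id (restrict_chain_mem _ _ _)) subrr.
    by rewrite /cdot big1 ?mulr0 // => s _; rewrite ffunE !mul0r.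
  have wW1 : w \in W1.
    rewrite W1P pchainP bw andbT.
    by have := subvsP w; rewrite pchainP => /andP[].
  by apply/eqP; rewrite -(dot_eq0 WP); apply/eqP/w0/(subvP (addvSr _ _)).
have xK2 : vsval x \in chain q K2.
  by rewrite (subvP (chain_pair _ KK)) // subvsP.
have /memv_addP[_ /memv_imgP[y yr ->] [w wW1 Tx]] :
    T (vsproj _ (vsval x)) \in (T @: lker r + W1)%VS by rewrite full memvf.
exists (vsproj (chain q K2) (vsval x) - y); split.
  by rewrite -W1P linearB /= -/T Tx addrAC subrr add0r.
move: yr; rewrite memv_ker lfunE /= => /eqP yr.
by rewrite !linearB /= yr subr0 vsprojK // restrict_chain_id // subvsP.
Qed.

(** [kth_eigenvalue_compare] applies with [pi] the restriction of chains from
    [K2] to [K1] and [G] the chains with coboundary in [pchain q K1 L1]. For [z]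
    in [G] the coboundary [c] of [z] relative to [K2] and [L1], and the
    coboundary [e] of [pi z] relative to [K1] and [L2], have the same inner
    product with [c], namely that of [boundary c] with [z]; hence [c] is no
    longer than [e]. *)
Lemma up_laplacian_kth_mono q k K1 K2 L1 L2 :
  simplicial_pair K1 K2 -> simplicial_pair L1 L2 -> (0 < k)%N ->
  (kth_eigenvalue k (up_laplacian q K2 L1) <=
   kth_eigenvalue k (up_laplacian q K1 L2))%E.
Proof.
move=> KK LL k0.
pose pi : 'Hom(subvs_of (chain q K2), subvs_of (chain q K1)) :=
  linfun (vsproj (chain q K1) \o restrict_chain q K1 \o vsval).
have piE z : vsval (pi z) = restrict_chain q K1 (vsval z).
  by rewrite lfunE /= vsprojK // restrict_chain_mem.
pose G : {vspace subvs_of (chain q K2)} :=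
  ((linfun vsval \o pcoboundary q K2 L1) @^-1: pchain q K1 L1)%VS.
have GP z : (z \in G) = (vsval (pcoboundary q K2 L1 z) \in pchain q K1 L1).
  by rewrite -memv_preim comp_lfunE lfunE.
apply: (@kth_eigenvalue_compare R _ _ _ _ _ _ pi G k
  (chain_inner_product q K1) (chain_inner_product q K2)
  (@up_laplacian_selfadjoint q K1 L2) (@up_laplacian_selfadjoint q K2 L1)) => //.
- by move=> x; rewrite up_laplacianE cdot_ge0.
- apply/eqP; rewrite eqEsubv subvf /=; apply/subvP => x _.
  have [z [zG zx]] := pcoboundary_lift L1 x KK.
  have -> : x = pi z by apply: val_inj; rewrite /= piE zx.
  by apply: memv_img; rewrite GP.
- move=> z; rewrite GP => cK1; rewrite !up_laplacianE.
  set c := vsval _ in cK1 *.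
  have [cL1 bc] : c \in chain q.+1 L1 /\ boundary c \in chain q K1.
    by move: cK1; rewrite pchainP => /andP[].
  have cL2 : c \in chain q.+1 L2 by exact: subvP (chain_pair _ LL) _ cL1.
  have cP : c \in pchain q K1 L2 by rewrite pchainP cL2.
  rewrite -(cdot_pair _ LL) //.
  have P2 := cdot_inner_product (subvv (chain q.+1 L2)).
  set e := vsval _.
  have eL2 : e \in chain q.+1 L2.
    by have := subvsP (pcoboundary q K1 L2 (pi z)); rewrite pchainP => /andP[].
  have := @dot_le_of_dot_eq _ _ _ P2 (vsproj _ c) (vsproj _ e).
  rewrite !vsprojK //; apply.
  rewrite pcoboundary_boundary // piE (cdot_pair _ LL) //.
  rewrite pcoboundary_boundary ?subvsP // (cdot_pair _ KK) //.
  by rewrite cdotC -cdot_restrict cdotC.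
- by move=> z _; rewrite piE cdot_restrict cdotC cdot_restrict cdot_pair_le.
Qed.

End Complexes.

Theorem theorem5p9 (R : realType) (d : Order.disp_t) (V : finOrderType d)
    (K L : filtration R V) (q k : nat) (hk : (0 < k)%N) :
  (interval_dist (up_eigenvalue_fun q k K) (up_eigenvalue_fun q k L)
     <= filtration_dist K L)%E.
Proof.
apply: ereal_inf_le_tmp => _ [e KLe <-]; exists e => // I.
split; apply: up_laplacian_kth_mono => //=.
- by have [+ _] := KLe (lo I - e%:num); rewrite subrK.
- by have [_] := KLe (hi I).
- by have [_ +] := KLe (lo I - e%:num); rewrite subrK.
- by have [+ _] := KLe (hi I).
Qed.
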